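(* Let $\Bbbk$ be an algebraically closed field of characteristic zero and let $\mathcal{K}$ be the $8$-dimensional non-semisimple non-pointed Hopf algebra over $\Bbbk$ described in the context. The partial actions of $\mathcal{K}$ on $\Bbbk$ are exactly the counit $\varepsilon_{\mathcal{K}}$ (the global action) and the linear maps $\lambda^0_{\{1,a^2\}}$, $\lambda_+$, $\lambda_-$ and $\lambda_\alpha$, for all $\alpha\in\Bbbk$.
   Context: A partial action of a Hopf algebra $H$ on its base field $\Bbbk$ is a linear map $\lambda:H\to\Bbbk$ with $\lambda(1_H)=1$ and $\lambda(u)\lambda(v)=\lambda(u_1)\lambda(u_2v)$ for all $u,v\in H$ (Sweedler notation $\Delta(u)=u_1\otimes u_2$). Let $\xi\in\Bbbk$ be a primitive eighth root of unity, $q:=\xi^2$, $\sqrt2:=\frac{2\xi}{1+\xi^2}$. The Hopf algebra $\mathcal{K}$ is generated as an algebra by $a,b,c,d$ with relations $a^4=ad=da=1$, $b^2=c^2=bc=cb=0$, $a^2c=b$, $ab=q\,ba$, $ac=q\,ca$, $bd=q\,db$, $cd=q\,dc$. It has linear basis $\mathcal{B}_{\mathcal{K}}=\{1,a,b,c,d,a^2,ab,ac\}$. Coproduct: $\Delta(1)=1\otimes1$, $\Delta(a^2)=a^2\otimes a^2$, $\Delta(a)=a\otimes a+b\otimes c$, $\Delta(b)=b\otimes d+a\otimes b$, $\Delta(c)=c\otimes a+d\otimes c$, $\Delta(d)=c\otimes b+d\otimes d$, $\Delta(ab)=ab\otimes1+a^2\otimes ab$, $\Delta(ac)=ac\otimes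 a^2+1\otimes ac$. Counit: $\varepsilon(1)=\varepsilon(a)=\varepsilon(a^2)=\varepsilon(d)=1$, $\varepsilon(b)=\varepsilon(c)=\varepsilon(ab)=\varepsilon(ac)=0$. Antipode: $S(a)=d$, $S(b)=qb$, $S(c)=-qc$, $S(d)=a$. Linear maps $\mathcal{K}\to\Bbbk$: - $\lambda^0_{\{1,a^2\}}(t)=1$ if $t\in\{1,a^2\}$ and $0$ for the other $t\in\mathcal{B}_{\mathcal{K}}$; - for $\alpha\in\Bbbk$: $\lambda_\alpha(1)=1$, $\lambda_\alpha(ab)=\lambda_\alpha(ac)=\alpha$, $\lambda_\alpha(a^2)=\lambda_\alpha(a)=\lambda_\alpha(b)=\lambda_\alpha(c)=\lambda_\alpha(d)=0$; - $\lambda_\pm(1)=1$, $\lambda_\pm(a^2)=0$, $\lambda_\pm(a)=\frac{1-q}{2}$, $\lambda_\pm(d)=\frac{1+q}{2}$, $\lambda_\pm(b)=\lambda_\pm(c)=\lambda_\pm(ab)=\lambda_\pm(ac)=\pm\frac{\sqrt2}{2}$. *)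

(* Defs.v *)
From HB Require Import structures.
From mathcomp Require Import all_boot all_order all_algebra all_field.
From mathcomp Require Import ring.

Set Implicit Arguments.
Unset Strict Implicit.
Unset Printing Implicit Defensive.

Import GRing.Theory.
Local Open Scope ring_scope.

Section TensorProduct.
Variable k : fieldType.

(* The tensor product of two finite-dimensional spaces, represented by the
   matrices of coordinates in the products of the vectors of the library's
   bases [vbasis fullv].  Its universal property, which no longer refers to
   these bases, is [tlift_tens] and [tensor_ind] below. *)
Definition tensor (V W : vectType k) := 'M[k]_(\dim {:V}, \dim {:W}).

Definition tens (V W : vectType k) (v : V) (w : W) : tensor V W :=
  \matrix_(i, j) (coord (vbasis {:V}) i v * coord (vbasis {:W}) j w).

(* The linear map on [tensor V W] that sends [tens v w] to [f v w], for a
   bilinear map [f]. *)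
Definition tlift (V W : vectType k) (U : lmodType k) (f : V -> W -> U)
    (t : tensor V W) : U :=
  \sum_i \sum_j t i j *: f (vbasis {:V})`_i (vbasis {:W})`_j.

Definition bilin (V W : vectType k) (U : lmodType k) (f : V -> W -> U) : Prop :=
  (forall w, linear (f^~ w)) /\ (forall v, linear (f v)).

Lemma tens_bilin (V W : vectType k) : bilin (@tens V W).
Proof.
split=> [w x u v|v x u w]; apply/matrixP=> i j; rewrite !mxE linearP /=.
  by rewrite mulrDl mulrA.
by rewrite mulrDr mulrCA.
Qed.

Lemma tlift_linear (V W : vectType k) (U : lmodType k) (f : V -> W -> U) :
  linear (tlift f).
Proof.
move=> x s t; rewrite /tlift scaler_sumr -big_split; apply: eq_bigr => i _ /=.
rewrite scaler_sumr -big_split; apply: eq_bigr => j _ /=.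
by rewrite !mxE scalerDl scalerA.
Qed.

Lemma tlift_tens (V W : vectType k) (U : lmodType k) (f : V -> W -> U) v w :
  bilin f -> tlift f (tens v w) = f v w.
Proof.
case=> fl fr.
pose flL w' := GRing.isLinear.Build k V U _ (f^~ w') (fl w').
pose fL w' : {linear V -> U} := HB.pack (f^~ w') (flL w').
pose frL v' := GRing.isLinear.Build k W U _ (f v') (fr v').
pose fR v' : {linear W -> U} := HB.pack (f v') (frL v').
rewrite {2}(coord_vbasis (memvf v)).
rewrite -[RHS]/(fL w _) linear_sum /=; apply: eq_bigr => i _.
rewrite -[RHS]/(fL w _) linearZ /= {2}(coord_vbasis (memvf w)).
rewrite -[f _ _]/(fR _ _) linear_sum /= scaler_sumr; apply: eq_bigr => j _.
by rewrite -[X in _ = _ *: X]/(fR _ _) linearZ /= scalerA mxE.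
Qed.

Lemma tensor_ind (V W : vectType k) (U : lmodType k) (f g : tensor V W -> U) :
  linear f -> linear g -> (forall v w, f (tens v w) = g (tens v w)) -> f =1 g.
Proof.
move=> lf lg fg t.
pose fL := GRing.isLinear.Build k (tensor V W) U _ f lf.
pose F : {linear tensor V W -> U} := HB.pack f fL.
pose gL := GRing.isLinear.Build k (tensor V W) U _ g lg.
pose G : {linear tensor V W -> U} := HB.pack g gL.
pose e i j := tens (vbasis {:V})`_i (vbasis {:W})`_j.
have eE i j : delta_mx i j = e i j.
  have fV := basis_free (vbasisP {:V}); have fW := basis_free (vbasisP {:W}).
  apply/matrixP=> i' j'; rewrite !mxE !coord_free // -natrM mulnb.
  by rewrite (eq_sym i) (eq_sym j).
have -> : t = \sum_i \sum_j t i j *: e i j.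
  rewrite {1}(matrix_sum_delta t); apply: eq_bigr => i _.
  by apply: eq_bigr => j _; rewrite eE.
rewrite -[LHS]/(F _) -[RHS]/(G _) !linear_sum; apply: eq_bigr => i _.
rewrite !linear_sum; apply: eq_bigr => j _.
by rewrite !linearZ; congr (_ *: _); apply: fg.
Qed.

End TensorProduct.

Section HopfAlgebra.
Variables (k : fieldType) (H : falgType k).

(* (x (x) y) (x' (x) y') = x x' (x) y y' *)
Definition tmul (s t : tensor H H) : tensor H H :=
  tlift (fun x y => tlift (fun x' y' => tens (x * x') (y * y')) t) s.

(* (x (x) y) (x) z |-> x (x) (y (x) z) *)
Definition tassoc (t : tensor (tensor H H) H) : tensor H (tensor H H) :=
  tlift (fun s z => tlift (fun x y => tens x (tens y z)) s) t.

Record hopf := Hopf {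
  comul : {linear H -> tensor H H};
  counit : {scalar H};
  antipode : {linear H -> H};
  comulA : forall u,
    tassoc (tlift (fun x y => tens (comul x) y) (comul u)) =
    tlift (fun x y => tens x (comul y)) (comul u);
  counitl : forall u, tlift (fun x y => counit x *: y) (comul u) = u;
  counitr : forall u, tlift (fun x y => counit y *: x) (comul u) = u;
  comul1 : comul 1 = tens 1 1;
  comulM : forall u v, comul (u * v) = tmul (comul u) (comul v);
  counit1 : counit 1 = 1;
  counitM : forall u v, counit (u * v) = counit u * counit v;
  antipodel : forall u, tlift (fun x y => antipode x * y) (comul u) = counit u *: 1;
  antipoder : forall u, tlift (fun x y => x * antipode y) (comul u) = counit u *: 1
}.

Definition partial_action (hH : hopf) (lam : {scalar H}) : Prop :=
  lam 1 = 1 /\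
  forall u v, lam u * lam v =
    tlift (fun u1 u2 => lam u1 * lam (u2 * v) : k^o) (comul hH u).

End HopfAlgebra.

Section HopfAlgebraK.
Variables (k : fieldType) (xi : k).

Definition qK : k := xi ^+ 2.
Definition sqrt2K : k := 2 * xi / (1 + xi ^+ 2).

Record K_relations (A : algType k) (a b c d : A) : Prop := KRelations {
  K_a4 : a ^+ 4 = 1;
  K_ad : a * d = 1;
  K_da : d * a = 1;
  K_b2 : b ^+ 2 = 0;
  K_c2 : c ^+ 2 = 0;
  K_bc : b * c = 0;
  K_cb : c * b = 0;
  K_a2c : a ^+ 2 * c = b;
  K_ab : a * b = qK *: (b * a);
  K_ac : a * c = qK *: (c * a);
  K_bd : b * d = qK *: (d * b);
  K_cd : c * d = qK *: (d * c)
}.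

Definition K_basis (A : algType k) (a b c d : A) : 8.-tuple A :=
  [tuple 1; a; b; c; d; a ^+ 2; a * b; a * c].

Record is_K (H : falgType k) (hH : hopf H) (a b c d : H) : Prop := IsK {
  (* H is the algebra presented by the generators a, b, c, d and the relations *)
  K_gen : agenv <<[:: a; b; c; d]>> = fullv;
  K_rel : K_relations a b c d;
  K_univ : forall (A : algType k) (a' b' c' d' : A),
    K_relations a' b' c' d' -> exists f : {lrmorphism H -> A},
      [/\ f a = a', f b = b', f c = c' & f d = d'];
  K_basisP : basis_of fullv (K_basis a b c d);
  K_comul1 : comul hH 1 = tens 1 1;
  K_comula2 : comul hH (a ^+ 2) = tens (a ^+ 2) (a ^+ 2);
  K_comula : comul hH a = tens a a + tens b c;
  K_comulb : comul hH b = tens b d + tens a b;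
  K_comulc : comul hH c = tens c a + tens d c;
  K_comuld : comul hH d = tens c b + tens d d;
  K_comulab : comul hH (a * b) = tens (a * b) 1 + tens (a ^+ 2) (a * b);
  K_comulac : comul hH (a * c) = tens (a * c) (a ^+ 2) + tens 1 (a * c);
  K_counit1 : counit hH 1 = 1;
  K_counita : counit hH a = 1;
  K_counita2 : counit hH (a ^+ 2) = 1;
  K_counitd : counit hH d = 1;
  K_counitb : counit hH b = 0;
  K_counitc : counit hH c = 0;
  K_counitab : counit hH (a * b) = 0;
  K_counitac : counit hH (a * c) = 0;
  K_antia : antipode hH a = d;
  K_antib : antipode hH b = qK *: b;
  K_antic : antipode hH c = - (qK *: c);
  K_antid : antipode hH d = a
}.

Section LinearMaps.
Variables (H : falgType k) (a b c d : H).

(* The linear map with prescribed values on 1, a, b, c, d, a^2, ab, ac. *)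
Definition K_form (v1 va vb vc vd va2 vab vac : k) (u : H) : k :=
  \sum_(i < 8) coord (K_basis a b c d) i u
                 * [:: v1; va; vb; vc; vd; va2; vab; vac]`_i.

Fact K_form_is_scalar v1 va vb vc vd va2 vab vac :
  scalar (K_form v1 va vb vc vd va2 vab vac).
Proof.
move=> x u v; rewrite /K_form mulr_sumr -big_split; apply: eq_bigr => i _ /=.
by rewrite linearP mulrDl mulrA.
Qed.

HB.instance Definition _ v1 va vb vc vd va2 vab vac :=
  GRing.isLinear.Build k H k _ (K_form v1 va vb vc vd va2 vab vac)
    (K_form_is_scalar v1 va vb vc vd va2 vab vac).

Definition lambda0 : {scalar H} := K_form 1 0 0 0 0 1 0 0.

Definition lambda_ (alpha : k) : {scalar H} := K_form 1 0 0 0 0 0 alpha alpha.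

Definition lambda_plus : {scalar H} :=
  let r := sqrt2K / 2 in
  K_form 1 ((1 - qK) / 2) r r ((1 + qK) / 2) 0 r r.

Definition lambda_minus : {scalar H} :=
  let r := - (sqrt2K / 2) in
  K_form 1 ((1 - qK) / 2) r r ((1 + qK) / 2) 0 r r.

End LinearMaps.

End HopfAlgebraK.

(* Main.v *)
(* Since lambda(u) lambda(v) = lambda(u_1) lambda(u_2 v) is bilinear in (u, v),
   it is a quadratic system in the values of lambda on the basis
   1, a, b, c, d, a^2, ab, ac.  Taking u = a^2 gives lambda(a^2) in {0, 1}.  If
   lambda(a^2) = 1, then lambda vanishes on b, c, ab, ac and takes one
   idempotent value on a and d.  If lambda(a^2) = 0, then u = ac gives
   lambda(ab) = lambda(ac) and lambda(b) = lambda(c).  In that case either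
   lambda(a) = 0, which leaves only lambda(ab) free, or
   (1 + q) lambda(a) = 1 and lambda(b)^2 = 1/2. *)

From HB Require Import structures.
Require Import Defs.
From mathcomp Require Import all_boot all_order all_algebra all_field.
From mathcomp Require Import ring.

Set Implicit Arguments.
Unset Strict Implicit.
Unset Printing Implicit Defensive.

Import GRing.Theory.
Local Open Scope ring_scope.

(** * Linear forms given by their values on a basis *)

Lemma eq_scalar_basis (k : fieldType) (V : vectType k) (n : nat)
    (X : n.-tuple V) (f g : V -> k) :
  basis_of fullv X -> scalar f -> scalar g -> {in X, f =1 g} -> f =1 g.
Proof.
move=> bX lf lg fg u.
pose F : {scalar V} := HB.pack f (GRing.isLinear.Build k V k _ f lf).
pose G : {scalar V} := HB.pack g (GRing.isLinear.Build k V k _ g lg).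
rewrite -[f u]/(F u) -[g u]/(G u) (coord_basis bX (memvf u)) !linear_sum.
by apply: eq_bigr => i _; rewrite !linearZ /= fg // mem_nth ?size_tuple.
Qed.

Lemma K_formE (k : fieldType) (H : falgType k) (a b c d : H)
    (v1 va vb vc vd va2 vab vac : k) (i : 'I_8) :
  free (K_basis a b c d) ->
  K_form a b c d v1 va vb vc vd va2 vab vac (K_basis a b c d)`_i =
  [:: v1; va; vb; vc; vd; va2; vab; vac]`_i.
Proof.
move=> fX; rewrite /K_form (bigD1 i) //= big1 ?addr0 => [|j ji].
  by rewrite (coord_free i i) // eqxx mul1r.
by rewrite (coord_free i j) // eq_sym (negPf ji) mul0r.
Qed.

Lemma eq_K_form (k : fieldType) (H : falgType k) (a b c d : H)
    (v1 va vb vc vd va2 vab vac : k) (lam : {scalar H}) :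
  basis_of fullv (K_basis a b c d) ->
  (lam =1 K_form a b c d v1 va vb vc vd va2 vab vac <->
   [/\ lam 1 = v1, lam a = va, lam b = vb & lam c = vc] /\
   [/\ lam d = vd, lam (a ^+ 2) = va2, lam (a * b) = vab & lam (a * c) = vac]).
Proof.
move=> bX.
have E i := K_formE v1 va vb vc vd va2 vab vac i (basis_free bX).
split=> [eL | [[e1 ea eb ec] [ed ea2 eab eac]]].
  have L (i : 'I_8) := etrans (eL (K_basis a b c d)`_i) (E i).
  by split; split; [exact: (L 0)|exact: (L 1)|exact: (L 2%:R)|exact: (L 3%:R)
    |exact: (L 4%:R)|exact: (L 5%:R)|exact: (L 6%:R)|exact: (L 7%:R)].
apply: (eq_scalar_basis bX (linearP _) (linearP _)) => u /(nthP 0)[i].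
rewrite size_tuple => lti <-.
apply: etrans (esym (E (Ordinal lti))).
by case: i lti => [|[|[|[|[|[|[|[]]]]]]]].
Qed.

(** * The partial action identity on basis vectors *)

Section PartialActionOnBasis.
Variables (k : fieldType) (H : falgType k) (hH : hopf H) (lam : {scalar H}).

(** An arbitrary tensor stands in place of the coproduct, so that the right side of the identity can
    be expanded over a sum of pure tensors. *)
Definition pa_rhs (t : tensor H H) (v : H) : k :=
  tlift (fun u1 u2 => lam u1 * lam (u2 * v) : k^o) t.

Lemma pa_rhs_tens x y v : pa_rhs (tens x y) v = lam x * lam (y * v).
Proof.
rewrite /pa_rhs tlift_tens //; split=> [w|w] r s t /=.
  by rewrite linearP mulrDl scalerAl.
by rewrite mulrDl -scalerAl linearP mulrDr mulrCA.
Qed.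

Lemma pa_rhsD s t v : pa_rhs (s + t) v = pa_rhs s v + pa_rhs t v.
Proof.
have /= := tlift_linear (fun u1 u2 => lam u1 * lam (u2 * v) : k^o) 1 s t.
by rewrite !scale1r.
Qed.

Lemma pa_rhsl x u w v :
  pa_rhs (comul hH (x *: u + w)) v =
  x * pa_rhs (comul hH u) v + pa_rhs (comul hH w) v.
Proof.
rewrite linearP.
exact: (tlift_linear (fun u1 u2 => lam u1 * lam (u2 * v) : k^o)).
Qed.

Lemma pa_rhsr t x v w :
  pa_rhs t (x *: v + w) = x * pa_rhs t v + pa_rhs t w.
Proof.
rewrite /pa_rhs /tlift mulr_sumr -big_split; apply: eq_bigr => i _ /=.
rewrite mulr_sumr -big_split; apply: eq_bigr => j _ /=.
by rewrite mulrDr -scalerAr linearP /GRing.scale /=; ring.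
Qed.

Lemma partial_action_basisP (n : nat) (X : n.-tuple H) :
  basis_of fullv X ->
  partial_action hH lam <->
  lam 1 = 1 /\ {in X &, forall u v, lam u * lam v = pa_rhs (comul hH u) v}.
Proof.
move=> bX; split=> [[lam1 lamM]|[lam1 lamM]]; split=> // u v.
change (lam u * lam v = pa_rhs (comul hH u) v).
have Ml w : scalar (fun u => lam u * lam w).
  by move=> x s t /=; rewrite linearP /=; ring.
have Mr w : scalar (fun v => lam w * lam v).
  by move=> x s t /=; rewrite linearP /=; ring.
apply: (eq_scalar_basis bX (Ml v) (fun x s t => pa_rhsl x s t v)) => {}u Bu.
apply: (eq_scalar_basis bX (Mr u) (pa_rhsr (comul hH u))) => {}v Bv.
exact: lamM.
Qed.

End PartialActionOnBasis.

(** * Normal forms of words in the generators *)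

Section Words.
Variables (k : fieldType) (xi : k) (A : algType k) (a b c d : A).
Hypothesis rel : K_relations xi a b c d.
Hypothesis qq : qK xi ^+ 2 = -1.
Local Notation q := (qK xi).

(* Words in a and c reduce to the normal forms a^i and a^i c, i < 4. *)
Lemma K_words :
  (((d = a * (a * a))%R * (b = a * (a * c))%R) *
   ((a * (a * (a * a)) = 1)%R * (forall x, a * (a * (a * (a * x))) = x)%R) *
   ((c * a = - q *: (a * c))%R *
    (forall x, c * (a * x) = - q *: (a * (c * x)))%R) *
   ((c * c = 0)%R * (forall x, c * (c * x) = 0)%R))%type.
Proof.
have aaaa : a * (a * (a * a)) = 1 by rewrite -(K_a4 rel) !exprS expr0 mulr1.
have dE : d = a * (a * a).
  by rewrite -[d]mulr1 -aaaa mulrA (K_da rel) mul1r.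
have cc : c * c = 0 by rewrite -expr2 (K_c2 rel).
(* Since [q ^+ 2 = -1], the inverse of [q] is [- q]. *)
have ca : c * a = - q *: (a * c).
  by rewrite (K_ac rel) scalerA mulNr -expr2 qq opprK scale1r.
split; [split; [split|]|]; split=> //.
- by rewrite -(K_a2c rel) expr2 mulrA.
- by move=> x; rewrite -[RHS]mul1r -aaaa !mulrA.
- by move=> x; rewrite mulrA ca -scalerAl mulrA.
- by move=> x; rewrite mulrA cc mul0r.
Qed.

Lemma in_K_basis (P : A -> Prop) u :
  P 1 -> P a -> P b -> P c -> P d -> P (a ^+ 2) -> P (a * b) -> P (a * c) ->
  u \in K_basis a b c d -> P u.
Proof.
move=> P1 Pa Pb Pc Pd Pa2 Pab Pac.
by rewrite !inE; do 7!(case/orP=> [/eqP -> //|]); move/eqP->.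
Qed.

End Words.

(** * Solving the quadratic system *)

Section Classification.
Variables (k : fieldType) (xi : k) (K : falgType k) (hK : hopf K).
Variables (a b c d : K) (isK : is_K xi hK a b c d).
Hypothesis qq : qK xi ^+ 2 = -1.
Variable lam : {scalar K}.
Local Notation q := (qK xi).
Let words := K_words (K_rel isK) qq.
Let comulE := (K_comul1 isK, K_comula isK, K_comulb isK, K_comulc isK,
  K_comuld isK, K_comula2 isK, K_comulab isK, K_comulac isK).

(** Reduced words are read back as basis vectors: [a ^+ 3 = d], [a ^+ 2 * c = b] and
    [a ^+ 3 * c = a * b]. *)
Lemma lam_words :
  ((lam (a * a)%R = lam (a ^+ 2)) * (lam (a * (a * a))%R = lam d) *
   (lam (a * (a * c))%R = lam b) *
   (lam (a * (a * (a * c)))%R = lam (a * b)%R))%type.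
Proof. by rewrite expr2; split; [split; [split|]|] => //; rewrite ?words. Qed.

(** Turns an instance of the identity into an equation between values of [lam] on the basis.
    Coproducts come first, because [words] eliminates [b] and [d]. *)
Ltac expand :=
  rewrite comulE ?(pa_rhsD, pa_rhs_tens) ?expr2 -?mulrA;
  do 4?rewrite ?(mul1r, mulr1, words) -?scalerAr -?mulrA;
  rewrite ?(scalerA, mulr0, scaler0, linearZ, linear0) /= ?lam_words.

(* The cases are {epsilon, lambda0}, lambda_alpha (F = alpha) and lambda_{+,-}
   (B = +-sqrt 2 / 2). *)
Definition K_parameters (A B D E F : k) : Prop :=
  [\/ [/\ E = 1, D = A, A * A = A, B = 0 & F = 0],
      [/\ E = 0, A = 0, B = 0 & D = 0]
    | [/\ E = 0, A = (1 - q) / 2, D = (1 + q) / 2, F = B & B * B = 2^-1]].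

(** Every partial action agrees on [b] and [c], and on [a * b] and [a * c], so five parameters
    suffice. *)
Definition K_values (A B D E F : k) : Prop :=
  [/\ lam 1 = 1, lam a = A, lam b = B & lam c = B] /\
  [/\ lam d = D, lam (a ^+ 2) = E, lam (a * b) = F & lam (a * c) = F].

Lemma K_parameters_partial_action A B D E F : 2 != 0 :> k ->
  K_parameters A B D E F -> K_values A B D E F -> partial_action hK lam.
Proof.
move=> two cases [[e1 ea eb ec] [ed ea2 eab eac]].
apply/(partial_action_basisP hK lam (K_basisP isK)); split=> //.
move=> u v Bu Bv; pattern u; apply: (in_K_basis _ _ _ _ _ _ _ _ Bu);
  pattern v; apply: (in_K_basis _ _ _ _ _ _ _ _ Bv).
all: expand.
all: rewrite ?(e1, ea, eb, ec, ed, ea2, eab, eac).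
all: clear e1 ea eb ec ed ea2 eab eac.
all: case: cases => [[? ? AA ? ?]|[? ? ? ?]|[? ? ? ? BB]]; subst.
all: try by ring: qq.
all: try by ring: qq AA.
(* Only goals of the third case are left; they involve halves and the relation [B * B = 2^-1]. *)
all: by rewrite ?(mulrCA B) ?BB; field: qq.
Qed.

Lemma partial_action_K_parameters : 2 != 0 :> k -> partial_action hK lam ->
  exists A B D E F, K_parameters A B D E F /\ K_values A B D E F.
Proof.
move=> two [lam1 lamM].
have pa u v : lam u * lam v = pa_rhs lam (comul hK u) v := lamM u v.
have q_neq0 : q != 0.
  apply: contraTneq (oner_neq0 k) => q0.
  by rewrite -oppr_eq0 -qq q0 expr0n eqxx.
(* Fifteen of the sixty-four instances on basis vectors determine the solutions. *)
have := pa (a ^+ 2) 1; expand; rewrite lam1 mulr1 => EE.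
have := pa a 1; expand; rewrite lam1 !mulr1 => AA.
have := pa (a ^+ 2) a; expand => EA.
have := pa (a ^+ 2) c; expand => EC.
have := pa (a ^+ 2) (a * b); expand => EF.
have := pa (a * b) 1; expand => F1.
have := pa (a * b) a; expand => FA.
have := pa (a * c) a; expand => GA.
have := pa (a * c) d; expand => GD.
have := pa (a * c) (a ^+ 2); expand => GE.
have := pa a a; expand => A2.
have := pa a b; expand => AB.
have := pa b a; expand => BA.
have := pa d d; expand => D2.
have := pa a (a ^+ 2); expand => AE.
rewrite lam1 in BA F1 GA GD GE.
exists (lam a), (lam b), (lam d), (lam (a ^+ 2)), (lam (a * b)).
rewrite /K_parameters /K_values.
(* From here on the values of [lam] are plain unknowns of a polynomial system. *)
move: (lam 1) (lam a) (lam b) (lam c) (lam d) (lam (a ^+ 2)) (lam (a * b))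
  (lam (a * c)) lam1 EE AA EA EC EF FA A2 AB BA D2 AE F1 GA GD GE =>
  l1 A B C D E F G -> EE AA EA EC EF FA A2 AB BA D2 AE F1 GA GD GE.
have [E1|E1] : E = 1 \/ E = 0.
  have /eqP : E * (E - 1) = 0 by rewrite mulrBr -EE; ring.
  by rewrite mulf_eq0 subr_eq0 => /orP[]/eqP; [right|left].
- rewrite E1 !mul1r in EA EC EF F1 FA.
  have F0 : F = 0 by apply: (addrI F); rewrite addr0 -[RHS]mulr1 F1 mulr1.
  have C0 : C = 0.
    apply: (mulfI q_neq0); rewrite mulr0; apply: (addrI (F * A + - q * C)).
    by rewrite addr0 -[RHS]FA; ring.
  have B0 : B = 0 by rewrite -EC.
  have G0 : G = 0 by rewrite -EF.
  split; last by rewrite C0 B0 G0 F0.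
  by constructor 1; split=> //; rewrite [RHS]AA B0; ring.
subst E.
have GF : F = G.
  by rewrite -[LHS]addr0 -(mulr0 G) GE; ring: qq.
(* Both [q * B] and [q * C] equal [G * (D - A)], by the instances at [a * c] with [a] and with
   [d]. *)
have GAD : q * B = G * (D - A).
  by rewrite mulrBr GA; ring.
have BC : B = C.
  by apply: (mulfI q_neq0); rewrite GAD mulrBr GD; ring: qq.
have AD : A * D = B * B.
  by rewrite -[RHS]addr0 -(mulr0 A) AE; ring: qq.
subst C G.
rewrite !(mulr0, mulr1, add0r, addr0) in A2 AB BA D2.
split=> //.
have [A0|A_neq0] := eqVneq A 0.
  have B0 : B = 0.
    by apply/eqP; rewrite -[_ == _]orbb -mulf_eq0 -AD A0 mul0r.
  constructor 2; split=> //.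
  by apply/eqP; rewrite -[_ == _]orbb -mulf_eq0 D2 B0 mul0r.
have BF : B = F by exact: (mulfI A_neq0).
subst F.
have B_neq0 : B != 0.
  apply: contraNneq A_neq0 => B0.
  by rewrite -[_ == _]orbb -mulf_eq0 A2 B0 mul0r.
have DA : D = 1 - A.
  by apply: (mulfI A_neq0); rewrite AD mulrBr mulr1 {1}AA; ring.
have A1 : (1 + q) * A = 1.
  by apply: (mulfI B_neq0); rewrite mulrDl mul1r mulrDr BA; ring.
(* The inverse of [1 + q] is [(1 - q) / 2], as [(1 - q) * (1 + q) = 1 - q ^+ 2 = 2]. *)
have AE' : A = (1 - q) / 2.
  apply: (mulfI two); rewrite mulrCA mulfV // mulr1.
  transitivity ((1 - q) * ((1 + q) * A)); first by ring: qq.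
  by rewrite A1 mulr1.
have DE : D = (1 + q) / 2 by rewrite DA AE'; field.
(* [B * B = A * D = (1 - q ^+ 2) / 4 = 1 / 2]. *)
constructor 3; split=> //; rewrite -AD AE' DE.
have four : 4 != 0 :> k by rewrite (natrM k 2 2) mulf_neq0.
by field: qq; rewrite ?four.
Qed.

End Classification.

(** * Matching the solutions with the named maps *)

Unset Implicit Arguments.

Theorem theorem4p1 (k : closedFieldType) (char0 : [pchar k] =i pred0)
    (xi : k) (xi_prim : 8.-primitive_root xi)
    (K : falgType k) (hK : hopf K) (a b c d : K)
    (isK : is_K xi hK a b c d) (lam : {scalar K}) :
  partial_action hK lam <->
  lam =1 counit hK \/
  lam =1 lambda0 a b c d \/
  lam =1 lambda_plus xi a b c d \/
  lam =1 lambda_minus xi a b c d \/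
  exists alpha : k, lam =1 lambda_ a b c d alpha.
Proof.
have two : 2 != 0 :> k by rewrite pcharf0P in char0; rewrite char0.
(* [xi ^+ 4] squares to 1 but is not 1, as 8 does not divide 4. *)
have qq : qK xi ^+ 2 = -1.
  rewrite /qK -exprM; apply/eqP.
  have : (xi ^+ 4 - 1) * (xi ^+ 4 + 1) == 0.
    by rewrite -subr_sqr_1 -exprM (prim_expr_order xi_prim) subrr.
  by rewrite mulf_eq0 subr_eq0 -(prim_order_dvd xi_prim) addr_eq0.
(* The denominator of [sqrt2K]: if it vanished, then [q = -1] and [q ^+ 2 = 1 = -1]. *)
have q1 : 1 + xi ^+ 2 != 0.
  rewrite addrC addr_eq0; apply: contra_neq two => q1.
  move: qq; rewrite /qK q1 sqrrN expr1n => /eqP.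
  by rewrite -subr_eq0 opprK => /eqP.
(* [(1 + q) ^+ 2 = 2 * q], so [sqrt2K] squares to [4 * q / (2 * q) = 2]. *)
have rr : sqrt2K xi / 2 * (sqrt2K xi / 2) = 2^-1.
  rewrite /sqrt2K; move: qq q1; rewrite /qK => qq q1.
  by field: qq; rewrite two.
have counitE : counit hK =1 K_form a b c d 1 1 0 0 1 1 0 0.
  by apply/(eq_K_form _ _ _ _ _ _ _ _ _ (K_basisP isK)); case: isK.
split.
  case/(partial_action_K_parameters isK qq two) => A [B [D [E [F [P V]]]]].
  have : lam =1 K_form a b c d 1 A B B D E F F.
    by apply/(eq_K_form _ _ _ _ _ _ _ _ _ (K_basisP isK)).
  case: P => [[-> -> AA -> ->]|[-> -> -> ->]|[-> -> -> -> BB]] lamE.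
  (* The idempotent [A] is 0 for [lambda0] and 1 for the counit. *)
  - have /orP[] : (A == 0) || (A - 1 == 0).
      by rewrite -mulf_eq0 mulrBr AA mulr1 subrr.
    + by move=> /eqP A0; right; left; rewrite A0 in lamE.
    + by rewrite subr_eq0 => /eqP A1; left => u; rewrite lamE A1 counitE.
  - by do 4!right; exists F.
  - have : (B - sqrt2K xi / 2) * (B + sqrt2K xi / 2) == 0.
      by rewrite -subr_sqr !expr2 BB rr subrr.
    rewrite mulf_eq0 subr_eq0 addr_eq0 => /orP[]/eqP Be; rewrite Be in lamE.
    + by do 2!right; left.
    + by do 3!right; left.
have lam_pa A B D E F : K_parameters xi A B D E F ->
    lam =1 K_form a b c d 1 A B B D E F F -> partial_action hK lam.
  move=> P /(eq_K_form _ _ _ _ _ _ _ _ _ (K_basisP isK)).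
  exact: (K_parameters_partial_action isK qq two P).
(* Conversely, each named map is an instance of [K_parameters]; explicit arguments are its values
   [A B D E F]. *)
case=> [lamE|[lamE|[lamE|[lamE|[alpha lamE]]]]].
- apply: (lam_pa 1 0 1 1 0); last by move=> u; rewrite lamE counitE.
  by constructor 1; rewrite mulr1.
- by apply: (lam_pa 0 0 0 1 0) lamE; constructor 1; rewrite mulr0.
- by apply: lam_pa lamE; constructor 3.
- by apply: lam_pa lamE; constructor 3; rewrite mulrNN.
- by apply: lam_pa lamE; constructor 2.
Qed.
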